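(* Let $\Bbbk$ be an algebraically closed field, let $P=\{p_1,\dots,p_{d-1}\}$ be a finite poset, and let $R=\Bbbk[P]$ be the Hibi ring associated with $P$. Let $e_1,\dots,e_n$ be the edges of the Hasse diagram of $\widehat P=P\cup\{\hat 0,\hat 1\}$, numbered so that $e_1,\dots,e_d$ form a spanning tree of this Hasse diagram, and identify $\mathrm{Cl}(R)$ with $\mathbb{Z}^{n-d}$ by letting $(a_1,\dots,a_{n-d})$ correspond to the isomorphism class of the divisorial ideal $T(0,\dots,0,a_1,\dots,a_{n-d})$ (with $d$ leading zeros). Then $(a_1,\dots,a_{n-d})\in\mathbb{Z}^{n-d}$ corresponds to a conic divisorial ideal of $R$ if and only if $(a_1,\dots,a_{n-d})\in\mathcal{C}(P)\cap\mathbb{Z}^{n-d}$, where $\mathcal{C}(P)\subset\mathbb{R}^{n-d}$ is the set of all $(z_1,\dots,z_{n-d})\in\mathbb{R}^{n-d}$ such that for every circuit $C$ in $\widehat P$ $$-|X_C^-|+1\ \le\ \sum_{e_{d+\ell}\in Z_C^+} z_\ell-\sum_{e_{d+\ell'}\in Z_C^-} z_{\ell'}\ \le\ |X_C^+|-1 .$$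
   Context: Poset notation. $\prec$ is the partial order of $P$; $\widehat P=P\cup\{\hat 0,\hat 1\}$ is obtained by adding a new minimum $p_0=\hat 0$ and a new maximum $p_d=\hat 1$. An edge of $\widehat P$ is a pair $\{p_i,p_j\}$ such that one of $p_i,p_j$ covers the other (an edge of the Hasse diagram). A spanning tree is a set of $d$ edges forming a spanning tree of the Hasse diagram of $\widehat P$ regarded as an undirected graph. Hibi ring. For each edge $e=\{p_i,p_j\}$ with $p_i\prec p_j$ define the linear form on $\mathbb{R}^d$, for $\mathbf{x}=(x_0,\dots,x_{d-1})$, by $\sigma_e(\mathbf{x})=x_i-x_j$ if $j\neq d$ and $\sigma_e(\mathbf{x})=x_i$ if $j=d$. The Hibi ring $\Bbbk[P]$ is the toric ring spanned over $\Bbbk$ by the Laurent monomials with exponent $\mathbf{x}\in\mathbb{Z}^d$ satisfying $\sigma_e(\mathbf{x})\ge 0$ for all edges $e$. (Equivalently, $\Bbbk[P]=\Bbbk[X^\alpha Y^m\mid \alpha\in m\mathcal{O}(P)\cap\mathbb{Z}^{d-1},\ m\ge 0]$, where $\mathcal{O}(P)=\{x\in[0,1]^{d-1}\mid x_i\ge x_j \text{ if } p_i\preceq p_j\}$ is the order polytope, the coordinate $x_0$ recording $m$.) Put $\sigma(\mathbf{x})=(\sigma_{e_1}(\mathbf{x}),\dots,\sigma_{e_n}(\mathbf{x}))\in\mathbb{R}^n$. Divisorial ideals. For $\mathbf{a}\in\mathbb{Z}^n$, $T(\mathbf{a})$ is the $R$-module spanned by the monomials with exponent $\mathbf{x}\in\mathbb{Z}^d$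 satisfying $\sigma_{e_i}(\mathbf{x})\ge a_i$ for all $i$. Every divisorial ideal (rank one reflexive module) is of this form, and $T(\mathbf{a})\cong T(\mathbf{a}')$ if and only if $\mathbf{a}-\mathbf{a}'\in\sigma(\mathbb{Z}^d)$, so $\mathrm{Cl}(R)\cong\mathbb{Z}^n/\sigma(\mathbb{Z}^d)\cong\mathbb{Z}^{n-d}$. With a spanning tree $e_1,\dots,e_d$ fixed, each divisorial ideal is isomorphic to $T(0,\dots,0,a_1,\dots,a_{n-d})$ for exactly one $(a_1,\dots,a_{n-d})\in\mathbb{Z}^{n-d}$. Conic. A divisorial ideal is conic if it is isomorphic to $T(\mathbf{a})$ for some $\mathbf{a}=\lceil\sigma(\mathbf{x})\rceil$ (componentwise round up) with $\mathbf{x}\in\mathbb{R}^d$. Cycles and circuits. A cycle in $\widehat P$ is a sequence $C=(p_{k_1},\dots,p_{k_m})$ of pairwise distinct elements forming a cycle in the Hasse diagram, i.e. each $\{p_{k_i},p_{k_{i+1}}\}$ ($1\le i\le m$, $p_{k_{m+1}}=p_{k_1}$) is an edge. It is a circuit if no two elements of $C$ that are not cyclically consecutive in $C$ form an edge of $\widehat P$. For a cycle $C$ put $X_C^+=\{\{p_{k_i},p_{k_{i+1}}\}\mid 1\le i\le m,\ p_{k_i}\prec p_{k_{i+1}}\}$, $X_C^-=\{\{p_{k_i},p_{k_{i+1}}\}\mid 1\le i\le m,\ p_{k_{i+1}}\prec p_{k_i}\}$, and $Z_C^{\pm}=X_C^{\pm}\cap\{e_{d+1},\dots,e_n\}$.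 *)

(* Defs.v *)
From HB Require Import structures.
From mathcomp Require Import all_boot all_order all_algebra.
From mathcomp Require Import finmap.
From mathcomp.multinomials Require Import monalg.
From mathcomp Require Import reals.

Set Implicit Arguments.
Unset Strict Implicit.
Unset Printing Implicit Defensive.

Import Order.TTheory GRing.Theory Num.Theory.
Local Open Scope fset_scope.
Local Open Scope ring_scope.

(* The group algebra k[M] of an additive abelian group M; for M = Z^d it is
   the ring of Laurent polynomials.  {malg k[M]} only carries a product when M
   is a monoid without nontrivial units, so the convolution product is built
   here on its underlying module. *)
Section GroupAlgebra.
Context (k : comNzRingType) (M : zmodType).

Definition group_algebra : Type := {malg k[M]}.
HB.instance Definition _ := GRing.Lmodule.on group_algebra.

Implicit Types g : group_algebra.

Definition ga_one : group_algebra := << 1 *g 0%R >>.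

Definition ga_mul g1 g2 : group_algebra :=
  \sum_(u <- msupp g1) \sum_(v <- msupp g2)
    << g1@_u * g2@_v *g (u + v)%R >>.

Fact ga_mulw (d1 d2 : {fset M}) g1 g2 :
  msupp g1 `<=` d1 -> msupp g2 `<=` d2 ->
  ga_mul g1 g2 =
  \sum_(u <- d1) \sum_(v <- d2) << g1@_u * g2@_v *g (u + v)%R >>.
Proof.
move=> le1 le2; rewrite /ga_mul (big_fset_incl _ le1) /=.
  apply: eq_bigr => u _; apply/big_fset_incl => // v _ /mcoeff_outdom ->.
  by rewrite mulr0 monalgU0.
move=> u _ /mcoeff_outdom g1u.
by rewrite big1 => // v _; rewrite g1u mul0r monalgU0.
Qed.

Fact ga_mulUU (c1 c2 : k) (u v : M) :
  ga_mul << c1 *g u >> << c2 *g v >> = << c1 * c2 *g (u + v)%R >>.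
Proof. by rewrite (ga_mulw msuppU_le msuppU_le) !big_seq_fset1 !mcoeffUU. Qed.

Fact ga_mulC : commutative ga_mul.
Proof.
move=> g1 g2; rewrite /ga_mul exchange_big; apply: eq_bigr => v _.
by apply: eq_bigr => u _; rewrite mulrC addrC.
Qed.

Fact ga_mulDl : left_distributive ga_mul +%R.
Proof.
move=> g1 g2 g.
rewrite [in RHS](ga_mulw (fsubsetUl _ (msupp g2)) (fsubset_refl _)).
rewrite [in RHS](ga_mulw (fsubsetUr (msupp g1) _) (fsubset_refl _)).
rewrite (ga_mulw (msuppD_le _ _) (fsubset_refl _)).
rewrite -big_split /=; apply: eq_bigr => u _.
rewrite -big_split /=; apply: eq_bigr => v _.
by rewrite mcoeffD mulrDl monalgUD.
Qed.

Fact ga_mul0g : left_zero 0 ga_mul.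
Proof. by move=> g; rewrite /ga_mul msupp0 big_seq_fset0. Qed.

Fact ga_mul1g : left_id ga_one ga_mul.
Proof.
move=> g; rewrite (ga_mulw msuppU_le (fsubset_refl _)) big_seq_fset1.
rewrite [RHS]monalgE; apply: eq_bigr => u _.
by rewrite mcoeffUU mul1r add0r.
Qed.

Fact ga_mul_suml (I : Type) (s : seq I) (F : I -> group_algebra) g :
  ga_mul (\sum_(i <- s) F i) g = \sum_(i <- s) ga_mul (F i) g.
Proof. exact: (big_morph (ga_mul^~ g) (fun _ _ => ga_mulDl _ _ _) (ga_mul0g _)). Qed.

Fact ga_mul_sumr (I : Type) (s : seq I) (F : I -> group_algebra) g :
  ga_mul g (\sum_(i <- s) F i) = \sum_(i <- s) ga_mul g (F i).
Proof. by rewrite ga_mulC ga_mul_suml; apply: eq_bigr => i _; rewrite ga_mulC. Qed.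

Fact ga_mulA : associative ga_mul.
Proof.
move=> g1 g2 g3.
rewrite [g1]monalgE; set s1 := msupp g1; set F1 := fun u => << g1@_u *g u >>.
rewrite [g2]monalgE; set s2 := msupp g2; set F2 := fun v => << g2@_v *g v >>.
rewrite [g3]monalgE; set s3 := msupp g3; set F3 := fun w => << g3@_w *g w >>.
rewrite !(ga_mul_suml s1 F1) (ga_mul_suml s1); apply: eq_bigr => u _.
rewrite (ga_mul_suml s2 F2) !(ga_mul_sumr s2) (ga_mul_suml s2).
apply: eq_bigr => v _; rewrite !(ga_mul_sumr s3).
by apply: eq_bigr => w _; rewrite !ga_mulUU mulrA addrA.
Qed.

Fact ga_one_neq0 : ga_one != 0.
Proof. by rewrite monalgU_eq0 oner_eq0. Qed.

HB.instance Definition _ := GRing.Zmodule_isComNzRing.Build group_algebra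
  ga_mulA ga_mulC ga_mul1g ga_mulDl ga_one_neq0.

Fact ga_msuppM g1 g2 w : w \in msupp (g1 * g2) ->
  exists u v, [/\ u \in msupp g1, v \in msupp g2 & w = u + v].
Proof.
rewrite -mcoeff_neq0 /GRing.mul /= /ga_mul raddf_sum /= => nz.
case: (boolP (has (fun u => has (fun v => w == u + v) (msupp g2)) (msupp g1))).
  by case/hasP=> u ug1 /hasP[v vg2 /eqP->]; exists u, v.
move=> /hasPn H; case/negP: nz; apply/eqP; rewrite big_seq big1 // => u ug1.
rewrite raddf_sum /= big_seq big1 // => v vg2.
have /hasPn/(_ _ vg2) := H _ ug1.
by rewrite mcoeffU eq_sym => /negbTE ->.
Qed.

End GroupAlgebra.

Section Hat.
Context {disp : Order.disp_t} (P : finPOrderType disp).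

Inductive hat := HBot | HElt of P | HTop.

Definition hat_code (h : hat) : option (option P) :=
  match h with HBot => None | HElt p => Some (Some p) | HTop => Some None end.
Definition hat_decode (o : option (option P)) : hat :=
  match o with None => HBot | Some (Some p) => HElt p | Some None => HTop end.
Fact hat_codeK : cancel hat_code hat_decode. Proof. by case. Qed.
HB.instance Definition _ := Finite.copy hat (can_type hat_codeK).

Definition hat_le (x y : hat) : bool :=
  match x, y with
  | HBot, _ | _, HTop => true
  | HElt p, HElt q => (p <= q)%O
  | _, _ => false
  end.

Fact hat_le_refl : reflexive hat_le. Proof. by case=> [|p|] /=. Qed.
Fact hat_le_anti : antisymmetric hat_le.
Proof. by case=> [|p|] [|q|] //= /le_anti ->. Qed.
Fact hat_le_trans : transitive hat_le.
Proof. by case=> [|q|] [|p|] [|s|] //=; apply: le_trans. Qed.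

HB.instance Definition _ := Order.Le_isPOrder.Build disp hat
  hat_le_refl hat_le_anti hat_le_trans.
Fact hat_le0 (x : hat) : (HBot <= x)%O. Proof. by []. Qed.
Fact hat_le1 (x : hat) : (x <= HTop)%O. Proof. by case: x. Qed.
HB.instance Definition _ := Order.hasBottom.Build disp hat hat_le0.
HB.instance Definition _ := Order.hasTop.Build disp hat hat_le1.

Definition covby (x y : hat) : bool :=
  (x < y)%O && [forall z, ~~ ((x < z)%O && (z < y)%O)].

(* An unordered pair {p_i, p_j} in which p_j covers p_i is represented by the
   ordered pair (p_i, p_j). *)
Definition edge : Type := {uv : hat * hat | covby uv.1 uv.2}.
HB.instance Definition _ := Finite.on edge.

Definition lower (f : edge) : hat := (val f).1.
Definition upper (f : edge) : hat := (val f).2.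

Definition adj (S : {set edge}) : rel hat := fun u v =>
  [exists f in S, ((lower f == u) && (upper f == v))
                  || ((lower f == v) && (upper f == u))].

(* [uniq] and [cycle] alone would also accept the empty sequence and a single
   edge traversed back and forth. *)
Definition is_cycle (S : {set edge}) (C : seq hat) : bool :=
  [&& 2 < size C, uniq C & cycle (adj S) C]%N.

Definition spanning_tree (S : {set edge}) : Prop :=
  (forall u v, connect (adj S) u v) /\ (forall C, ~~ is_cycle S C).

Definition circuit (C : seq hat) : Prop :=
  is_cycle [set: edge] C /\
  {in C &, forall u v,
     next C u != v -> next C v != u -> ~~ adj [set: edge] u v}.

Definition Xplus (C : seq hat) : {set edge} :=
  [set f | (lower f \in C) && (next C (lower f) == upper f)].
Definition Xminus (C : seq hat) : {set edge} :=
  [set f | (upper f \in C) && (next C (upper f) == lower f)].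

(* The coordinates (x_0, ..., x_(d-1)) are indexed by the elements
   p_0, ..., p_(d-1) themselves: [None] stands for p_0, the minimum of the hat
   of P, and [Some p] for p.  There is no coordinate at the maximum p_d, where
   the value 0 is used, so that [sigma x f] is x_i - x_j or, if j = d, x_i. *)
Definition coord (V : zmodType) (x : {ffun option P -> V}) (h : hat) : V :=
  match h with HBot => x None | HElt p => x (Some p) | HTop => 0 end.

Definition sigma (V : zmodType) (x : {ffun option P -> V}) (f : edge) : V :=
  coord x (lower f) - coord x (upper f).

Fact sigma0 (V : zmodType) f : sigma (0 : {ffun option P -> V}) f = 0.
Proof.
by rewrite /sigma; case: (lower f) => *; case: (upper f) => *;
   rewrite /= ?ffunE subrr.
Qed.

Fact coordD (V : zmodType) h :
  {morph (fun x : {ffun option P -> V} => coord x h) : x y / x + y}.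
Proof. by move=> x y; case: h => [|p|] /=; rewrite ?ffunE ?addr0. Qed.

Fact sigmaD (V : zmodType) f :
  {morph (fun x : {ffun option P -> V} => sigma x f) : x y / x + y}.
Proof. by move=> x y; rewrite /sigma !coordD opprD addrACA. Qed.

End Hat.

Section HibiRing.
Context (k : fieldType) {disp : Order.disp_t} (P : finPOrderType disp).

Definition laurent : Type := group_algebra k {ffun option P -> int}.
HB.instance Definition _ := GRing.ComNzRing.on laurent.

Definition hibi_pred : {pred laurent} := fun g =>
  all (fun x => [forall f : edge P, 0 <= sigma x f]) (msupp g).

Fact hibi_predP g :
  reflect {in msupp g, forall x (f : edge P), 0 <= sigma x f} (g \in hibi_pred).
Proof.
apply: (iffP allP) => H x xg; first by apply/forallP/H.
by apply/forallP/H.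
Qed.

Fact hibi_subring : subring_closed hibi_pred.
Proof.
split=> [|g1 g2 /hibi_predP H1 /hibi_predP H2|
         g1 g2 /hibi_predP H1 /hibi_predP H2]; apply/hibi_predP => x.
- by move=> /(fsubsetP msuppU_le); rewrite inE => /eqP-> f; rewrite sigma0.
- by move=> /(fsubsetP (msuppB_le _ _)); rewrite inE => /orP[/H1|/H2].
- by case/ga_msuppM => u [v [/H1 Hu /H2 Hv ->]] f; rewrite sigmaD addr_ge0.
Qed.
HB.instance Definition _ := GRing.isSubringClosed.Build laurent hibi_pred
  hibi_subring.

Definition hibi_ring : Type := {g : laurent | g \in hibi_pred}.
HB.instance Definition _ := SubChoice.on hibi_ring.
HB.instance Definition _ :=
  [SubChoice_isSubComNzRing of hibi_ring by <:].

Section Divisorial.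
Context (n : nat) (e : 'I_n -> edge P) (a : 'rV[int]_n).

Definition divisorial_pred : {pred laurent} := fun g =>
  all (fun x => [forall i, a 0 i <= sigma x (e i)]) (msupp g).

Fact divisorial_predP g :
  reflect {in msupp g, forall x i, a 0 i <= sigma x (e i)}
          (g \in divisorial_pred).
Proof.
apply: (iffP allP) => H x xg; first by apply/forallP/H.
by apply/forallP/H.
Qed.

Fact divisorial_zmod : zmod_closed divisorial_pred.
Proof.
split=> [|g1 g2 /divisorial_predP H1 /divisorial_predP H2];
  apply/divisorial_predP => x; first by rewrite msupp0.
by move=> /(fsubsetP (msuppB_le _ _)); rewrite inE => /orP[/H1|/H2].
Qed.
HB.instance Definition _ := GRing.isZmodClosed.Build laurent divisorial_pred
  divisorial_zmod.

Definition divisorial : Type := {g : laurent | g \in divisorial_pred}.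
HB.instance Definition _ := SubChoice.on divisorial.
HB.instance Definition _ := [SubChoice_isSubZmodule of divisorial by <:].

Fact divisorial_scale_subproof (r : hibi_ring) (t : divisorial) :
  val r * val t \in divisorial_pred.
Proof.
apply/divisorial_predP => x /ga_msuppM [u [v [ur vt ->]]] i.
rewrite sigmaD -[a 0 i]add0r lerD //.
  exact: (hibi_predP _ (valP r)).
exact: (divisorial_predP _ (valP t)).
Qed.

Definition divisorial_scale (r : hibi_ring) (t : divisorial) : divisorial :=
  Sub (val r * val t) (divisorial_scale_subproof r t).

Fact divisorial_scaleA r s t :
  divisorial_scale r (divisorial_scale s t) = divisorial_scale (r * s) t.
Proof. by apply: val_inj; rewrite /= mulrA. Qed.
Fact divisorial_scale1 : left_id 1 divisorial_scale.
Proof. by move=> t; apply: val_inj; rewrite /= mul1r. Qed.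
Fact divisorial_scaleDr : right_distributive divisorial_scale +%R.
Proof. by move=> r s t; apply: val_inj; rewrite /= mulrDr. Qed.
Fact divisorial_scaleDl t : {morph divisorial_scale^~ t : r s / r + s}.
Proof. by move=> r s; apply: val_inj; rewrite /= mulrDl. Qed.

HB.instance Definition _ := GRing.Zmodule_isLmodule.Build hibi_ring divisorial
  divisorial_scaleA divisorial_scale1 divisorial_scaleDr divisorial_scaleDl.

End Divisorial.
End HibiRing.

Definition module_iso (A : nzRingType) (M N : lmodType A) : Prop :=
  exists f : {linear M -> N}, bijective f.

Definition conic (R : realType) (k : fieldType) (disp : Order.disp_t)
    (P : finPOrderType disp) (n : nat) (e : 'I_n -> edge P)
    (M : lmodType (hibi_ring k P)) : Prop :=
  exists x : {ffun option P -> R},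
    module_iso M (divisorial k e (\row_i Num.ceil (sigma x (e i)))).

Section ConicRegion.
Context (R : realType) (disp : Order.disp_t) (P : finPOrderType disp).
Context (d r : nat) (e : 'I_(d + r) -> edge P).

Definition nontree_edges : {set edge P} := [set e (rshift d l) | l : 'I_r].

Definition Zplus (C : seq (hat P)) : {set edge P} :=
  Xplus C :&: nontree_edges.
Definition Zminus (C : seq (hat P)) : {set edge P} :=
  Xminus C :&: nontree_edges.

Definition in_conic_region (z : 'rV[R]_r) : Prop :=
  forall C : seq (hat P), circuit C ->
    - #|Xminus C|%:R + 1
      <= \sum_(l < r | e (rshift d l) \in Zplus C) z 0 l
         - \sum_(l < r | e (rshift d l) \in Zminus C) z 0 l
      <= #|Xplus C|%:R - 1.

End ConicRegion.

(* Main.v *)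
(* An isomorphism T(a) -> T(b) is multiplication by an element h of the Laurent
   ring; its inverse is too, so that h is a unit and hence a monomial times a
   constant.  Every condition sigma_e(x) >= a_e is attained on the monomials of
   T(a), because the ends of an edge e can be identified without creating a
   directed cycle; hence b - a = sigma(y) for an integral y.  Thus T(0, a) is
   conic if and only if (0, a) is itself the round-up of sigma(x) for a real x,
   i.e. if the difference constraints b_e - 1 < x_i - x_j <= b_e with b = (0, a)
   are feasible.  Summing them along a cycle gives the inequalities; conversely
   least weights of paths give a solution as soon as the inequalities hold on
   all cycles, and chords reduce cycles to circuits. *)
Require Import Defs.
From HB Require Import structures.
From mathcomp Require Import all_boot all_order all_algebra.
From mathcomp Require Import finmap lra.
From mathcomp.multinomials Require Import monalg.
From mathcomp Require Import reals.

Set Implicit Arguments.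
Unset Strict Implicit.
Unset Printing Implicit Defensive.

Import Order.TTheory GRing.Theory Num.Theory.
Local Open Scope ring_scope.

(** * Sums along walks and cycles; potentials for arc weights *)

Section CyclicSums.
Context (T : eqType) (V : zmodType).
Implicit Types (F : T -> T -> V) (x y : T) (p q C : seq T).

Fixpoint psum F x p : V := if p is y :: q then F x y + psum F y q else 0.

Definition csum F C : V := \sum_(x <- C) F x (next C x).

Lemma psum_cat F x p q : psum F x (p ++ q) = psum F x p + psum F (last x p) q.
Proof. by elim: p x => [|y p IHp] x /=; rewrite ?add0r // IHp addrA. Qed.

Lemma psum_nth F x p :
  psum F x p = \sum_(i < size p) F (nth x (x :: p) i) (nth x p i).
Proof.
elim: p x => [|y p IHp] x /=; first by rewrite big_ord0.
rewrite big_ord_recl /= IHp; congr (_ + _); apply: eq_bigr => i _.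
by congr (F _ _); apply: set_nth_default; rewrite /= ?ltnS // ltnW.
Qed.

(** Opens a cycle at its head, so that cutting and gluing of paths applies to cyclic sums. *)
Lemma csum_psum F x p : uniq (x :: p) -> csum F (x :: p) = psum F x (rcons p x).
Proof.
move=> Up; rewrite psum_nth /csum (big_nth x) big_mkord size_rcons.
apply: eq_bigr => -[i ltip] _; rewrite [nat_of_ord _]/=.
rewrite next_nth mem_nth // index_uniq // -rcons_cons nth_rcons ltip.
(* At the last position the successor is the head [x], returned as the default value of [nth]. *)
congr (F _ _); rewrite nth_rcons; case: ltnP => // lepi.
by rewrite nth_default // if_same.
Qed.

Lemma csum_rot F n C : uniq C -> csum F (rot n C) = csum F C.
Proof.
move=> UC; rewrite /csum (perm_big C) /=; last by rewrite perm_rot.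
by apply: eq_bigr => x _; rewrite next_rot.
Qed.

Lemma csumD F F' C :
  csum (fun x y => F x y + F' x y) C = csum F C + csum F' C.
Proof. exact: big_split. Qed.

Lemma csumB F F' C :
  csum (fun x y => F x y - F' x y) C = csum F C - csum F' C.
Proof. exact: sumrB. Qed.

Lemma csum_telescope (g : T -> V) C :
  uniq C -> csum (fun x y => g x - g y) C = 0.
Proof.
case: C => [|x p] Up; first by rewrite /csum big_nil.
rewrite csum_psum //.
have -> q y : psum (fun x y => g x - g y) y q = g y - g (last y q).
  elim: q y => [|z q IHq] y /=; first by rewrite subrr.
  by rewrite IHq addrA subrK.
by rewrite last_rcons subrr.
Qed.

End CyclicSums.

Lemma csum_rmorph (T : eqType) (R S : pzRingType) (f : {rmorphism R -> S})
    (F : T -> T -> R) C :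
  f (csum F C) = csum (fun x y => f (F x y)) C.
Proof. exact: rmorph_sum. Qed.

Lemma csum_gt0 (T : eqType) (R : realDomainType) (F : T -> T -> R) C :
  {in C, forall x, 0 <= F x (next C x)} ->
  (exists2 x, x \in C & 0 < F x (next C x)) -> 0 < csum F C.
Proof.
move=> F_ge0 [x xC Fx]; rewrite /csum big_seq_cond.
rewrite (big_rem x) //= xC /= ltr_pwDl // big_seq_cond sumr_ge0 // => y.
by case/and3P=> /mem_rem yC _ _; apply: F_ge0.
Qed.

(* q x is the least weight of a simple path starting at x. *)
Lemma potential_of_nonneg_cycles (T : finType) (G : rel T) (w : T -> T -> int) :
  (forall x p, uniq (x :: p) -> path G x (rcons p x) ->
     0 <= psum w x (rcons p x)) ->
  exists q : T -> int, forall x y, G x y -> q x - q y <= w x y.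
Proof.
move=> w_ge0.
pose simple x (p : #|T|.-bseq T) := uniq (x :: p) && path G x p.
pose best x := [arg min_(p < [bseq] | simple x p) psum w x p]%O.
have bestP x : simple x (best x) /\
    forall p, uniq (x :: p) -> path G x p -> psum w x (best x) <= psum w x p.
  rewrite /best; case: arg_minP => [|p xp minp]; first by rewrite /simple.
  split=> // s Us Gs; have les : (size s <= #|T|)%N.
    by rewrite ltnW // -[(size s).+1]/(size (x :: s)) -(card_uniqP Us) max_card.
  by apply: (minp (Bseq les)); rewrite /simple Us.
exists (fun x => psum w x (best x)) => x y Gxy; have [exy|nxy] := eqVneq x y.
  rewrite -{}exy in Gxy *; rewrite subrr.
  by have := w_ge0 x [::] isT; rewrite /= Gxy addr0; apply.
have [/andP[Uy Py] _] := bestP y; have [_ minx] := bestP x.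
rewrite lerBlDr; move: Uy Py; set p := bseqval (best y) => Uy Py.
case: (boolP (x \in y :: p)) => [|xNp]; last first.
  by apply: (minx (y :: p)) => /=; rewrite ?xNp ?Gxy.
rewrite inE (negPf nxy) /= => xp.
(* Here [x] lies on the best path from [y]: the arc to [y] and the path up to [x] close a cycle of
   nonnegative weight, and the rest [p2] is a simple path from [x]. *)
case/splitPr: xp Uy Py => p1 p2 Uy.
rewrite -cat_rcons cat_path last_rcons => /andP[P1 P2].
rewrite psum_cat last_rcons addrA.
have le2 : psum w x (best x) <= psum w x p2.
  apply: minx => //; move: Uy; rewrite -cat_cons cat_uniq.
  by case/and3P.
apply: le_trans le2 _; rewrite lerDr.
apply: (w_ge0 x (y :: p1)) => /=; last by rewrite Gxy.
move: Uy; rewrite -cat_rcons -cat_cons cat_uniq => /andP[+ _].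
by rewrite -rcons_cons rcons_uniq.
Qed.

(** * The Hasse diagram, its cycles and the weights of its arcs *)

Section HatGraph.
Context {disp : Order.disp_t} (P : finPOrderType disp).
Implicit Types (u v : hat P) (f : edge P) (C : seq (hat P)).

Local Notation adjT := (adj [set: edge P]).

Lemma covby_lt u v : covby u v -> (u < v)%O.
Proof. by case/andP. Qed.

Lemma covby_asym u v : covby u v -> ~~ covby v u.
Proof.
by move=> /covby_lt uv; apply/negP => /covby_lt; rewrite lt_gtF.
Qed.

Lemma edge_covby f : covby (lower f) (upper f).
Proof. exact: (valP f). Qed.

Lemma covby_edge u v : covby u v -> exists2 f, lower f = u & upper f = v.
Proof. by move=> uv; exists (exist _ (u, v) uv). Qed.

Lemma edge_eqE f f' :
  (lower f == lower f') && (upper f == upper f') = (f == f').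
Proof. by rewrite -val_eqE /lower /upper -pair_eqE. Qed.

Lemma adjTE u v : adjT u v = covby u v || covby v u.
Proof.
apply/existsP/orP => [[f /andP[_]] | [] /covby_edge[f <- <-]].
- by case/orP=> /andP[/eqP<- /eqP<-]; [left | right]; apply: edge_covby.
- by exists f; rewrite inE !eqxx.
- by exists f; rewrite inE !eqxx orbT.
Qed.

Lemma adjT_sym : symmetric adjT.
Proof. by move=> u v; rewrite !adjTE orbC. Qed.

Lemma adjT_irr : irreflexive adjT.
Proof. by move=> u; rewrite adjTE orbb /covby ltxx. Qed.

Lemma is_cycle_uniq C : is_cycle [set: edge P] C -> uniq C.
Proof. by case/and3P. Qed.

Lemma is_cycle_next C u :
  is_cycle [set: edge P] C -> u \in C -> adjT u (next C u).
Proof. by case/and3P=> _ _; apply: next_cycle. Qed.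

(** If [r] held all along the cycle, transitivity would relate its first element to itself. *)
Lemma exists_next_unrelated (r : rel (hat P)) C :
  transitive r -> irreflexive r -> uniq C -> C != [::] ->
  exists2 u, u \in C & ~~ r u (next C u).
Proof.
move=> tr ir UC nC; apply/hasP; rewrite has_predC; apply/negP => /allP rC.
have := cycle_from_next UC rC; case: C {UC rC} nC => // u p _ /=.
move=> /(order_path_min tr) /allP/(_ u).
by rewrite ir mem_rcons mem_head => /(_ isT).
Qed.

(** A cycle cannot ascend throughout. The descending arc makes an inequality strict when slacks are
    summed. *)
Lemma is_cycle_down C : is_cycle [set: edge P] C ->
  exists2 u, u \in C & covby (next C u) u.
Proof.
move=> cC; have UC := is_cycle_uniq cC.
have [|u uC nlt] := exists_next_unrelated lt_trans ltxx UC.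
  by case: C cC {UC}.
exists u => //; have := is_cycle_next cC uC; rewrite adjTE.
by case/orP=> // /covby_lt lt; rewrite lt in nlt.
Qed.

Lemma is_cycle_up C : is_cycle [set: edge P] C ->
  exists2 u, u \in C & covby u (next C u).
Proof.
move=> cC; have UC := is_cycle_uniq cC.
have [|u uC nlt] := exists_next_unrelated (rev_trans lt_trans) ltxx UC.
  by case: C cC {UC}.
exists u => //; have := is_cycle_next cC uC; rewrite adjTE.
by case/orP=> // /covby_lt lt; rewrite lt in nlt.
Qed.

Section ArcFunction.
Context (V : zmodType).
Implicit Types G : edge P -> V.

(** Two elements are the ends of at most one edge, so this is the value of [G] on an ascending arc
    and 0 on every other pair. *)
Definition earc G u v : V := \sum_(f | (lower f == u) && (upper f == v)) G f.

Lemma earc_edge G f : earc G (lower f) (upper f) = G f.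
Proof.
by rewrite /earc (eq_bigl (pred1 f)) ?big_pred1_eq.
Qed.

Lemma earc_rev G f : earc G (upper f) (lower f) = 0.
Proof.
apply: big_pred0 => f'; apply/negP => /andP[/eqP lo /eqP up].
by have := covby_asym (edge_covby f); rewrite -lo -up edge_covby.
Qed.

(** The edges are grouped by their lower ends, each element of [C] carrying at most the edge to its
    successor. *)
Lemma sum_Xplus G C : uniq C -> \sum_(f in Xplus C) G f = csum (earc G) C.
Proof.
move=> UC; rewrite /csum big_uniq //=.
rewrite (partition_big (@lower _ P) (mem C)) /= => [|f]; last first.
  by rewrite inE => /andP[].
apply: eq_bigr => u uC; apply: eq_bigl => f; rewrite inE andbC eq_sym andbA.
by rewrite [upper _ == _]eq_sym; case: eqP => [<-|//]; rewrite uC.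
Qed.

Lemma sum_Xminus G C :
  uniq C -> \sum_(f in Xminus C) G f = csum (fun u v => earc G v u) C.
Proof.
move=> UC; rewrite /csum big_uniq //=.
rewrite (partition_big (@upper _ P) (mem C)) /= => [|f]; last first.
  by rewrite inE => /andP[].
apply: eq_bigr => u uC; apply: eq_bigl => f; rewrite inE.
rewrite [lower _ == _]eq_sym andbC.
by case: (upper f =P u) => [->|_]; rewrite ?uC ?andbT ?andbF.
Qed.

End ArcFunction.

Section Weight.
Context (R : pzRingType).
Implicit Types B : edge P -> R.

(* The bounds B f - 1 < sigma x f <= B f say that x_u - x_v is at most B f when
   u -> v goes up along f, and less than 1 - B f when it goes down. *)
Definition weight B u v : R := earc B u v + earc (fun f => 1 - B f) v u.

Lemma weight_up B f : weight B (lower f) (upper f) = B f.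
Proof. by rewrite /weight earc_edge earc_rev addr0. Qed.

Lemma weight_down B f : weight B (upper f) (lower f) = 1 - B f.
Proof. by rewrite /weight earc_edge earc_rev add0r. Qed.

Lemma weight_sym B u v : adjT u v -> weight B u v + weight B v u = 1.
Proof.
rewrite adjTE => /orP[] /covby_edge[f <- <-]; rewrite weight_up weight_down.
  by rewrite addrC subrK.
by rewrite subrK.
Qed.

Lemma csum_weight B C : uniq C ->
  csum (weight B) C = \sum_(f in Xplus C) B f - \sum_(f in Xminus C) B f
                      + #|Xminus C|%:R.
Proof.
move=> UC; rewrite csumD -sum_Xplus // -sum_Xminus // sumrB sumr_const.
by rewrite [_ - \sum_(f in _) _]addrC addrA.
Qed.

End Weight.

(* A chord splits a cycle into two shorter ones, traversing it in opposite
   directions; as the two weights of the chord add up to 1, the bound for the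
   shorter cycles gives it for the whole. *)
Lemma cycle_weight_ge1 (B : edge P -> int) :
  (forall C, circuit C -> 1 <= csum (weight B) C) ->
  forall C, is_cycle [set: edge P] C -> 1 <= csum (weight B) C.
Proof.
move=> circB C; have [m] := ubnP (size C); elim: m C => // m IHm C szC cC.
have UC := is_cycle_uniq cC.
pose chordless u v := [|| next C u == v, next C v == u | ~~ adjT u v].
case: (boolP (all (fun u => all (chordless u) C) C)) => [/allP nochord|].
  apply: circB; split=> // u v uC vC nuv nvu.
  by have /allP/(_ v vC)/or3P[/eqP e|/eqP e|//] := nochord u uC;
    [rewrite e eqxx in nuv | rewrite e eqxx in nvu].
rewrite -has_predC => /hasP[u uC] /=; rewrite -has_predC => /hasP[v vC] /=.
rewrite !negb_or negbK => /and3P[nuv nvu uv].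
(* The cycle is rotated to start at the end [u] of the chord; [v] then cuts the rest into [p1] and
   [p2], both nonempty because [u] and [v] are not consecutive. *)
case: (rot_to uC) => i C' eC.
have {cC}: is_cycle [set: edge P] (u :: C').
  by rewrite -eC /is_cycle size_rot rot_uniq rot_cycle.
rewrite -(csum_rot _ i UC) -!(next_rot i UC) -(size_rot i) -(mem_rot i)
  in vC nuv nvu szC *.
rewrite {}eC in vC nuv nvu szC *; move: vC; rewrite inE => /orP[/eqP evu|].
  by rewrite evu adjT_irr in uv.
move=> vC' cC {UC C uC chordless}.
case/splitPr: vC' nuv nvu szC cC => p1 p2.
case: p1 => [|x p1]; first by rewrite /= !eqxx.
case: p2 => [|y p2] nuv nvu szC cC.
  case/eqP: nvu; have := is_cycle_uniq cC.
  rewrite next_nth !(inE, mem_cat) eqxx !orbT.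
  rewrite -!cat_cons => U; rewrite index_cat; move: U; rewrite cat_uniq /= orbF.
  case/and3P=> _ /negPf-> _; rewrite eqxx addn0 nth_default //.
  by rewrite /= size_cat addn1.
have := cC => /and3P[_ U].
rewrite [cycle _ _]/= rcons_cat cat_path /=.
case/and3P=> ux pathx /and3P[lastv vy pathy].
(* The chord closes [C1] from [v] to [u] and [C2] from [u] to [v]. *)
set C1 := u :: rcons (x :: p1) v; set C2 := v :: rcons (y :: p2) u.
have U1 : uniq C1.
  by move: U; rewrite -cat_cons -cat_rcons cat_uniq => /andP[].
have U2 : uniq C2.
  move: U; rewrite /C2 -rcons_cons rcons_uniq cons_uniq mem_cat negb_or.
  rewrite cat_uniq.
  by case/andP=> /andP[_ ->] /and3P[].
have cC1 : is_cycle [set: edge P] C1.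
  rewrite /is_cycle U1 /= size_rcons /= rcons_path rcons_path last_rcons.
  by rewrite ux pathx lastv adjT_sym.
have cC2 : is_cycle [set: edge P] C2.
  rewrite /is_cycle U2 /= size_rcons /= rcons_path last_rcons.
  by rewrite vy pathy uv.
have /(IHm C1)/(_ cC1) : (size C1 < m)%N.
  move: szC; rewrite ltnS; apply: leq_trans; rewrite /= size_rcons size_cat /=.
  by rewrite !addnS !ltnS leq_addr.
have /(IHm C2)/(_ cC2) : (size C2 < m)%N.
  move: szC; rewrite ltnS; apply: leq_trans; rewrite /= size_rcons size_cat /=.
  by rewrite !addnS !ltnS leq_addl.
rewrite !csum_psum ?(is_cycle_uniq cC) //= rcons_cat -!cats1 psum_cat /=.
rewrite !psum_cat /= psum_cat !last_cat /= !addr0.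
have := weight_sym B uv; clear; lra.
Qed.

End HatGraph.

(** * Round-ups and the cycle inequalities *)

Section Potentials.
Context {disp : Order.disp_t} (P : finPOrderType disp).
Implicit Types (u v : hat P) (f : edge P) (C : seq (hat P)).

(** As [coord] is 0 at the maximum, [g] is shifted to vanish there; differences stay the same. *)
Definition of_potential (V : zmodType) (g : hat P -> V) :
    {ffun option P -> V} :=
  [ffun o => g (oapp (@HElt _ P) (HBot P) o) - g (HTop P)].

Lemma sigma_of_potential (V : zmodType) (g : hat P -> V) f :
  sigma (of_potential g) f = g (lower f) - g (upper f).
Proof.
have coordE h : Defs.coord (of_potential g) h = g h - g (HTop P).
  by case: h => [|p|] /=; rewrite ?ffunE // subrr.
by rewrite /sigma !coordE opprB addrA subrK.
Qed.

Lemma csum_weight_rev (R : pzRingType) (B : edge P -> R) C : uniq C ->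
  csum (fun u v => weight B v u) C
  = #|Xplus C|%:R - (\sum_(f in Xplus C) B f - \sum_(f in Xminus C) B f).
Proof.
move=> UC; rewrite csumD -sum_Xminus // -sum_Xplus // sumrB sumr_const.
by rewrite opprB addrC addrAC -addrA.
Qed.

(** Each arc has slack at least 0, and more than 0 if it descends. Around a cycle the coordinates
    cancel and the slacks add up to the integral weight, which is therefore at least 1. The reversed
    cycle gives the upper bound. *)
Lemma cycle_bounds (R : archiRealDomainType) (x : {ffun option P -> R})
    (B : edge P -> int) C :
  (forall f, Num.ceil (sigma x f) = B f) -> is_cycle [set: edge P] C ->
  - #|Xminus C|%:R + 1 <= \sum_(f in Xplus C) B f - \sum_(f in Xminus C) B f
                       <= #|Xplus C|%:R - 1.
Proof.
move=> xB cC; have UC := is_cycle_uniq cC.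
pose slack u v : R := (weight B u v)%:~R - (Defs.coord x u - Defs.coord x v).
have slack_down u v : covby v u -> 0 < slack u v.
  case/covby_edge=> f <- <-; rewrite /slack weight_down -opprB opprK.
  have := ceil_itv (sigma x f); rewrite xB /sigma => /andP[lt _].
  by move: lt; rewrite !intrB; clear; lra.
have slack_ge0 u v : adj [set: edge P] u v -> 0 <= slack u v.
  rewrite adjTE => /orP[/covby_edge[f <- <-]|/slack_down/ltW//].
  rewrite /slack weight_up subr_ge0.
  by have := ceil_itv (sigma x f); rewrite xB => /andP[].
have gt0 : 0 < csum (weight B) C.
  rewrite -(ltr_int R) (csum_rmorph (intmul 1)).
  rewrite -[X in _ < X]subr0 -(csum_telescope (Defs.coord x) UC) -csumB.
  apply: csum_gt0 => [u uC|]; first exact/slack_ge0/is_cycle_next.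
  by have [u uC /slack_down] := is_cycle_down cC; exists u.
have rev_gt0 : 0 < csum (fun u v => weight B v u) C.
  rewrite -(ltr_int R) (csum_rmorph (intmul 1)).
  rewrite -[X in _ < X]addr0 -(csum_telescope (Defs.coord x) UC) -csumD.
  rewrite (_ : csum _ C = csum (fun u v => slack v u) C); last first.
    by apply: eq_bigr => u _; rewrite /slack opprB.
  apply: csum_gt0 => [u uC|].
    by apply: slack_ge0; rewrite adjT_sym; apply: is_cycle_next.
  by have [u uC /slack_down] := is_cycle_up cC; exists u.
move: gt0 rev_gt0; rewrite csum_weight // csum_weight_rev // !gtz0_ge1.
by move: (\sum_(f in _) _) (\sum_(f in _) _) => s t; clear; lra.
Qed.

(* The strict inequalities B f - 1 < sigma x f become the closed ones
   B f - 1 + 1 / N <= sigma x f, where N exceeds the number of edges. *)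
Lemma ceil_sigma_exists (R : archiRealFieldType) (B : edge P -> int) :
  (forall C, circuit C -> 1 <= csum (weight B) C) ->
  exists x : {ffun option P -> R}, forall f, Num.ceil (sigma x f) = B f.
Proof.
move=> /cycle_weight_ge1 cycB.
pose N := #|{: edge P}|.+1.
pose one (f : edge P) : int := 1.
(* Scaling by [N] makes the bounds integral; the 1 taken off descending arcs is the scaled term 1 /
   [N]. *)
pose w u v : int := N%:R * weight B u v - earc one v u.
have csum_w C : uniq C -> csum w C = N%:R * csum (weight B) C - #|Xminus C|%:R.
  by move=> UC; rewrite csumB -sum_Xminus // sumr_const /csum mulr_sumr.
have [|q qP] := @potential_of_nonneg_cycles _ (adj [set: edge P]) w.
  (* Closed walks of length two run back and forth along an edge; they are not cycles, and their
     weight is [N - 1]. *)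
  move=> u [|v [|v' p]] Up; first by rewrite /= adjT_irr.
    rewrite /= => /and3P[uv _ _]; rewrite addr0 /w.
    have : earc one v u + earc one u v = 1.
      move: uv; rewrite adjTE => /orP[] /covby_edge[f <- <-].
        by rewrite earc_edge earc_rev add0r.
      by rewrite earc_edge earc_rev addr0.
    move=> one_vu; rewrite addrACA -mulrDr (weight_sym B uv) -opprD one_vu.
    by rewrite mulr1 subr_ge0 ler1n.
  move=> Cp; rewrite -csum_psum // csum_w // subr_ge0.
  have cC : is_cycle [set: edge P] [:: u, v, v' & p] by rewrite /is_cycle Up.
  have := cycB _ cC.
  have : (#|Xminus [:: u, v, v' & p]| <= N)%N by rewrite ltnW // ltnS max_card.
  (* The cycle has weight at least 1, so [N] times it outweighs the units taken off its descending
     edges. *)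
  move=> leN W1; apply: (@le_trans _ _ N%:R); first by rewrite ler_nat.
  by rewrite ler_peMr.
exists (of_potential (fun h => (q h)%:~R / N%:R)) => f.
rewrite sigma_of_potential -mulrBl -rmorphB; apply: ceil_def.
have N0 : 0 < N%:R :> R by rewrite ltr0n.
have := qP (lower f) (upper f); have := qP (upper f) (lower f).
rewrite !adjTE edge_covby orbT /w weight_up weight_down earc_rev earc_edge.
move=> /(_ isT) le1 /(_ isT) le2.
rewrite ltr_pdivlMr // ler_pdivrMr // -[N%:R](@mulrz_nat R) -!intrM.
rewrite ltr_int ler_int; move: le1 le2; rewrite /one subr0.
rewrite !natz mulrBr mulr1 mulrBl mul1r mulrC; clear; lra.
Qed.

End Potentials.

(** * Units of the Laurent polynomial ring *)

Section GroupAlgebraUnits.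
Context (k : idomainType).

Section Monomials.
Context (M : zmodType).
Implicit Types (g : group_algebra k M) (u v x y : M).

Definition monom x : group_algebra k M := << 1 *g x >>.

Lemma monomM x y : monom x * monom y = monom (x + y).
Proof. by rewrite /GRing.mul /= ga_mulUU mulr1. Qed.

Lemma monom0 : monom 0 = 1.
Proof. by []. Qed.

Lemma monomVK x g : monom x * (monom (- x) * g) = g.
Proof. by rewrite mulrA monomM subrr monom0 mul1r. Qed.

Lemma msupp_monom x : msupp (monom x) = [fset x]%fset.
Proof. by rewrite msuppU oner_eq0. Qed.

Lemma mcoeff_ga_mul g1 g2 w :
  (g1 * g2)@_w = \sum_(u <- msupp g1) \sum_(v <- msupp g2)
                    g1@_u * g2@_v *+ (u + v == w).
Proof.
rewrite /GRing.mul /= /ga_mul raddf_sum; apply: eq_bigr => u _.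
by rewrite raddf_sum; apply: eq_bigr => v _; rewrite /= mcoeffU.
Qed.

(** Every other pair of exponents has a smaller value under [lam], so the coefficient at [x + y] is
    a product of two nonzero coefficients. *)
Lemma ga_mul_extremal (lam : M -> int) g1 g2 x y :
  {morph lam : u v / u + v} ->
  x \in msupp g1 -> {in msupp g1, forall u, u != x -> lam u < lam x} ->
  y \in msupp g2 -> {in msupp g2, forall v, v != y -> lam v < lam y} ->
  x + y \in msupp (g1 * g2).
Proof.
move=> lamD xg1 xmax yg2 ymax; rewrite -mcoeff_neq0 mcoeff_ga_mul.
have le1 u : u \in msupp g1 -> lam u <= lam x.
  by move=> ug1; have [->//|/(xmax u ug1)/ltW] := eqVneq u x.
have le2 v : v \in msupp g2 -> lam v <= lam y.
  by move=> vg2; have [->//|/(ymax v vg2)/ltW] := eqVneq v y.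
rewrite (bigD1_seq x) ?fset_uniq //= (bigD1_seq y) ?fset_uniq //= eqxx.
rewrite [X in _ + X + _]big1_seq => [|v /andP[nvy vg2]]; last first.
  by rewrite (inj_eq (addrI x)) (negPf nvy).
rewrite [X in _ + X]big1_seq => [|u /andP[nux ug1]].
  by rewrite !addr0 mulf_neq0 // mcoeff_neq0.
apply: big1_seq => v /andP[_ vg2]; case: eqP => // /(congr1 lam).
rewrite !lamD => e.
have := xmax u ug1 nux; have := le2 v vg2; clear -e => H1 H2.
by have := ltr_leD H2 H1; rewrite e ltxx.
Qed.

End Monomials.

Lemma exists_argmax (T : eqType) (lam : T -> int) (s : seq T) :
  s != [::] -> exists2 x, x \in s & {in s, forall u, lam u <= lam x}.
Proof.
elim: s => // x [|y s] IHs _.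
  by exists x => [|u]; rewrite ?mem_head // inE => /eqP->.
have [z zs zmax] := IHs isT; have [lexz|ltzx] := leP (lam x) (lam z).
  exists z => [|u]; first by rewrite inE zs orbT.
  by rewrite inE => /predU1P[->|/zmax].
exists x => [|u]; first exact: mem_head.
rewrite inE => /predU1P[->//|/zmax le]; exact: le_trans le (ltW ltzx).
Qed.

Section FreeAbelian.
Context (I : finType).
Local Notation M := {ffun I -> int}.

(** A vector becomes the polynomial with these coefficients, and [lam] is evaluation at an integer
    that is a root of none of the polynomials from [D]. *)
Lemma exists_nonvanishing_functional (D : seq M) : 0 \notin D ->
  exists2 lam : M -> int, {morph lam : u v / u + v} &
    {in D, forall u, lam u != 0}.
Proof.
move=> D0; pose pol (u : M) : {poly int} := \sum_i u i *: 'X^(enum_rank i).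
have pol_neq0 u : u \in D -> pol u != 0.
  move=> uD; have /eqP/ffunP nu : u != 0 by apply: contraNneq D0 => <-.
  apply/negP => /eqP pu0; apply: nu => i; rewrite ffunE.
  have := congr1 (fun p : {poly int} => p`_(enum_rank i)) pu0.
  rewrite coef0 /pol coef_sum (bigD1 i) //= coefZ coefXn eqxx mulr1.
  rewrite big1 ?addr0 // => j nji; rewrite coefZ coefXn.
  by rewrite (inj_eq val_inj) (inj_eq enum_rank_inj) eq_sym (negPf nji) mulr0.
pose p := \prod_(u <- D) pol u.
have p_neq0 : p != 0.
  by rewrite prodf_seq_neq0; apply/allP => u /pol_neq0.
(* A nonzero polynomial has fewer roots than its size, so one of 0, ..., [size p - 1] is not a
   root. *)
have /allPn[t _ ntp] : ~~ all (root p) (map Posz (iota 0 (size p))).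
  apply/negP => /(max_poly_roots p_neq0); rewrite map_inj_uniq ?iota_uniq.
    by rewrite size_map size_iota ltnn; move=> /(_ isT).
  by move=> ? ? [].
exists (fun u => (pol u).[t]) => [u v|u uD].
  rewrite -hornerD; congr _.[t]; rewrite /pol -big_split /=.
  by apply: eq_bigr => i _; rewrite ffunE scalerDl.
apply: contraNneq ntp => pu0.
by rewrite /root horner_prod (big_rem u) //= pu0 mul0r.
Qed.

(* Separate the exponents of g and h by an additive functional: the terms on
   which it is extremal survive in the product, so that if g h = 1 its maximum
   and minimum on the support of g coincide. *)
Lemma ga_unit_monom (g h : group_algebra k M) :
  g * h = 1 -> exists x, msupp g = [fset x]%fset.
Proof.
move=> gh1.
(* A functional that is nonzero on all these differences is injective on each support. *)
pose diffs (s : seq M) := [seq d <- [seq u - v | u <- s, v <- s] | d != 0].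
have [|lam lamD lam0] :=
  @exists_nonvanishing_functional (diffs (msupp g) ++ diffs (msupp h)).
  by rewrite mem_cat !mem_filter eqxx.
have lamN u : lam (- u) = - lam u.
  have lam00 : lam 0 = 0 by apply: (addrI (lam 0)); rewrite -lamD !addr0.
  by apply: (addrI (lam u)); rewrite -lamD !subrr lam00.
have lam_inj f : f = g \/ f = h -> {in msupp f &, injective lam}.
  move=> fgh u v uf vf e; apply/eqP; rewrite -subr_eq0; apply: contraT => nuv.
  have /lam0 : u - v \in diffs (msupp g) ++ diffs (msupp h).
    have uvf : u - v \in diffs (msupp f).
      by rewrite mem_filter nuv; apply/allpairsP; exists (u, v).
    by rewrite mem_cat; case: fgh => <-; rewrite uvf ?orbT.
  by rewrite lamD lamN e subrr eqxx.
have nz f : f = g \/ f = h -> (msupp f : seq M) != [::].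
  move=> fgh; apply: contra_eq_neq gh1 => f0.
  have f_eq0 : f = 0 by rewrite [f]monalgE f0 big_nil.
  case: fgh => <-; rewrite f_eq0 ?mul0r ?mulr0 eq_sym oner_eq0 //.
have strict f x (mu : M -> int) : f = g \/ f = h -> x \in msupp f ->
    (forall u v, mu u = mu v -> lam u = lam v) ->
    {in msupp f, forall u, mu u <= mu x} ->
    {in msupp f, forall u, u != x -> mu u < mu x}.
  move=> fgh xf inj xmax u uf nux; rewrite lt_neqAle xmax // andbT.
  by apply: contra_neq nux => /inj; apply: (lam_inj f).
have extremal (mu : M -> int) : {morph mu : u v / u + v} ->
    (forall u v, mu u = mu v -> lam u = lam v) ->
    exists x y, [/\ x + y = 0, x \in msupp g, y \in msupp h,
      {in msupp g, forall u, mu u <= mu x} &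
      {in msupp h, forall u, mu u <= mu y}].
  move=> muD inj.
  have [x xg xmax] := exists_argmax mu (nz g (or_introl erefl)).
  have [y yh ymax] := exists_argmax mu (nz h (or_intror erefl)).
  exists x, y; split=> //; apply/eqP.
  have := ga_mul_extremal muD xg (strict g x mu (or_introl erefl) xg inj xmax)
            yh (strict h y mu (or_intror erefl) yh inj ymax).
  by rewrite gh1 -monom0 msupp_monom inE.
have [x [y [xy0 xg yh xmax ymax]]] := extremal lam lamD (fun _ _ => id).
have [||x' [y' [xy0' xg' yh' xmin ymin]]] := extremal (fun u => - lam u).
- by move=> u v; rewrite lamD opprD.
- by move=> u v; apply: oppr_inj.
exists x; apply/fsetP => u; rewrite inE; apply/idP/eqP => [ug|->//].
apply: (lam_inj g) => //; first by left.
have yE : lam y = - lam x.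
  by rewrite -lamN; congr lam; apply/eqP; rewrite -addr_eq0 addrC xy0.
have yE' : lam y' = - lam x'.
  by rewrite -lamN; congr lam; apply/eqP; rewrite -addr_eq0 addrC xy0'.
(* [lam y' <= lam y] means [lam x <= lam x'], while [lam x' <= lam u <= lam x]. *)
have := xmax u ug; have := xmin u ug; have := ymin y yh; rewrite yE yE'.
by clear; lra.
Qed.

End FreeAbelian.
End GroupAlgebraUnits.

(** Used with monomials [m] and [x] to turn m x phi(t) = m t phi(s) into phi(t) = (phi(s) / x) t. *)
Lemma mulr_cancel_unit (A : comPzRingType) (m m' x x' s t u : A) :
  m' * m = 1 -> x' * x = 1 -> m * x * u = m * t * s -> u = x' * s * t.
Proof.
move=> mK xK e; have {}e : x * u = t * s.
  by rewrite -[LHS]mul1r -mK -mulrA [m * _]mulrA e -mulrA mulrA mK mul1r.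
by rewrite -[LHS]mul1r -xK -mulrA e mulrCA mulrC.
Qed.

Lemma mulr_fixed_unit (A : comPzRingType) (h h' x x' : A) :
  x * x' = 1 -> h' * (h * x) = x -> h * h' = 1.
Proof. by move=> xx' hx; rewrite -[RHS]xx' -{}hx -!mulrA xx' mulr1 mulrC. Qed.

(** * Attaining the bound at one edge *)

Section Facets.
Context {disp : Order.disp_t} (P : finPOrderType disp).
Implicit Types (u v z : hat P) (f : edge P).

(* The principal filter of u in the poset where the two ends of f are
   identified. *)
Definition contracted_filter f u : {set hat P} :=
  [set z | (u <= z)%O || (u <= upper f)%O && (lower f <= z)%O].

Lemma contracted_filter_lower_upper f :
  contracted_filter f (lower f) = contracted_filter f (upper f).
Proof.
have /ltW leluf := covby_lt (edge_covby f).
apply/setP => z; rewrite !inE lexx leluf orbb /= orb_idl //.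
exact: le_trans.
Qed.

(** [lower f'] lies in the larger filter only: otherwise [lower f <= lower f' < upper f' <= upper
    f], and covering would force [f' = f]. *)
Lemma contracted_filter_proper f f' : f' != f ->
  contracted_filter f (upper f') \proper contracted_filter f (lower f').
Proof.
move=> nf; have lt' := covby_lt (edge_covby f').
apply/properP; split.
  apply/subsetP => z; rewrite !inE => /orP[le|/andP[le ->]].
    by rewrite (le_trans (ltW lt') le).
  by rewrite (le_trans (ltW lt') le) orbT.
exists (lower f'); rewrite !inE ?lexx // negb_or (lt_geF lt') /=.
apply/negP => /andP[leu lel]; case/negP: nf; rewrite -edge_eqE.
have /andP[_ /forallP btw] := edge_covby f.
have elo : lower f' = lower f.
  apply/eqP; apply: contraT => nlo; have := btw (lower f').
  by rewrite lt_neqAle eq_sym nlo lel (lt_le_trans lt' leu).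
rewrite elo eqxx /=; apply: contraT => nup; have := btw (upper f').
by rewrite -elo lt' lt_neqAle nup leu.
Qed.

(** Across [f] the filters agree, and only the extra [c f] at its lower end is seen. Across any
    other edge the filter shrinks, which gains at least [m] plus the absolute value of [c f]: enough
    for the bound there and for the effect of the extra term. *)
Lemma exists_tight (c : edge P -> int) f :
  exists x : {ffun option P -> int},
    sigma x f = c f /\ forall f', c f' <= sigma x f'.
Proof.
pose m : int := \sum_f' `|c f'|.
have lem f' : `|c f'| <= m by rewrite /m (bigD1 f') //= lerDl sumr_ge0.
pose g u : int :=
  (m + `|c f|) * #|contracted_filter f u|%:R + c f *+ (u == lower f).
exists (of_potential g); have nlu : upper f == lower f = false.
  by apply/eqP => e; have := covby_lt (edge_covby f); rewrite e ltxx.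
have sf : sigma (of_potential g) f = c f.
  rewrite sigma_of_potential /g contracted_filter_lower_upper eqxx nlu.
  by rewrite addr0 addrC addKr.
split=> // f'; have [->|nf'] := eqVneq f' f; first by rewrite sf.
rewrite sigma_of_potential /g.
have := proper_card (contracted_filter_proper nf').
move: #|contracted_filter f (upper f')| #|contracted_filter f (lower f')|.
move: (lower f' == _) (upper f' == _) => s t a b ltab.
have : 1 <= b%:R - a%:R :> int by rewrite lerBrDr nat1r ler_nat.
have := lem f'; have := ler_norm (c f'); have := normr_ge0 (c f').
have n_ge0 := normr_ge0 (c f).
have : - `|c f| <= c f *+ s - c f *+ t.
  have := ler_norm (c f); have := ler_norm (- c f); rewrite normrN.
  by case: s t => [] []; rewrite /= ?mulr0n ?mulr1n; clear; lra.
move: (c f *+ s) (c f *+ t) (b%:R) (a%:R) => S T B A.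
clear lem sf g; move: m `|c f'| `|c f| n_ge0 => m' n' n h0 h1 h2 h3 h4 h5.
have : m' + n <= (m' + n) * (B - A).
  by rewrite ler_peMr //; clear -h0 h2 h4; lra.
by rewrite mulrBr; clear -h1 h3 h4; lra.
Qed.

Lemma exists_sigma_ge (c : edge P -> int) :
  exists x : {ffun option P -> int}, forall f, c f <= sigma x f.
Proof.
case: (pickP (@predT (edge P))) => [f _|no]; last first.
  by exists 0 => f; have := no f.
by have [x [_ xge]] := exists_tight c f; exists x.
Qed.

End Facets.

(** * Homomorphisms and isomorphisms of divisorial ideals *)

Section DivisorialIso.
Context (k : fieldType) {disp : Order.disp_t} (P : finPOrderType disp).
Context (n : nat) (e : 'I_n -> edge P) (e_bij : bijective e).
Implicit Types (a b : 'rV[int]_n) (x y : {ffun option P -> int}).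

Lemma row_edge a : exists c : edge P -> int, forall i, c (e i) = a 0 i.
Proof.
by have [g eK _] := e_bij; exists (fun f => a 0 (g f)) => i; rewrite eK.
Qed.

Lemma exists_tight_row a i : exists x,
  sigma x (e i) = a 0 i /\ forall j, a 0 j <= sigma x (e j).
Proof.
have [c ce] := row_edge a; have [x [xi xge]] := exists_tight c (e i).
by exists x; split=> [|j]; rewrite ?xi -ce.
Qed.

Lemma monom_divisorial a x :
  (monom k x \in divisorial_pred e a) = [forall i, a 0 i <= sigma x (e i)].
Proof.
rewrite /in_mem /= /divisorial_pred msupp_monom.
apply/allP/idP => [|H y]; first by apply; rewrite inE.
by rewrite inE => /eqP->.
Qed.

Lemma monom_hibi a x (t : divisorial k e a) :
  (forall i, - a 0 i <= sigma x (e i)) ->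
  monom k x * val t \in @hibi_pred k _ P.
Proof.
move=> xge; apply/hibi_predP => z /ga_msuppM[u [v [+ vt ->]]] f.
rewrite msupp_monom inE => /eqP->; have [g _ gK] := e_bij.
rewrite -(gK f) sigmaD -(addNr (a 0 (g f))) lerD //.
exact: (divisorial_predP _ _ _ (valP t)).
Qed.

(* For s, t in the first module and a monomial m with m s and m t in R one has
   phi (m s t) = m s phi t = m t phi s, so that phi t / t is constant. *)
Lemma divisorial_hom_mul a b
    (phi : {linear divisorial k e a -> divisorial k e b}) :
  exists h : laurent k P, forall t, val (phi t) = h * val t.
Proof.
have [c ce] := row_edge a.
(* [x] provides a monomial [s] in T(a), and [m] one that carries T(a) into R. *)
have [x xge] := exists_sigma_ge c.
have [m mge] := exists_sigma_ge (fun f => - c f).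
have xP : monom k x \in divisorial_pred e a.
  by rewrite monom_divisorial; apply/forallP => i; rewrite -ce.
pose s : divisorial k e a := Sub (monom k x) xP.
exists (monom k (- x) * val (phi s)) => t.
have mP (t' : divisorial k e a) : monom k m * val t' \in @hibi_pred k _ P.
  by apply: monom_hibi => i; rewrite -ce.
pose R_ t' : hibi_ring k P := Sub (monom k m * val t') (mP t').
have eq_scale : R_ s *: t = R_ t *: s by apply: val_inj; apply: mulrAC.
have eq_phi : R_ s *: phi t = R_ t *: phi s by rewrite -!linearZ eq_scale.
apply: (@mulr_cancel_unit (laurent k P) _ (monom k (- m))
  _ _ _ _ _ _ _ (congr1 val eq_phi)).
  by rewrite monomM addNr.
by rewrite monomM addNr.
Qed.

Lemma divisorial_iso_translate a b :
  module_iso (divisorial k e a) (divisorial k e b) ->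
  exists y, forall i, b 0 i = a 0 i + sigma y (e i).
Proof.
case=> phi [psi phiK psiK].
have [h hE] := divisorial_hom_mul phi.
have psi_lin : linear psi.
  by move=> c u v; apply: (can_inj phiK); rewrite linearP !psiK.
pose psiL := HB.pack_for {linear divisorial k e b -> divisorial k e a} psi
  (GRing.isLinear.Build _ _ _ _ psi psi_lin).
have [h' h'E] := divisorial_hom_mul psiL.
have [c ce] := row_edge a; have [x xge] := exists_sigma_ge c.
have xP : monom k x \in divisorial_pred e a.
  by rewrite monom_divisorial; apply/forallP => i; rewrite -ce.
have hh1 : h * h' = 1.
  apply: (@mulr_fixed_unit (laurent k P) h h' (monom k x) (monom k (- x))).
    by rewrite monomM subrr.
  have := congr1 val (phiK (Sub (monom k x) xP)).
  by rewrite -[psi]/(psiL : _ -> _) h'E hE.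
have [y hy] := ga_unit_monom hh1.
have [y' hy'] : exists y', msupp h' = [fset y']%fset.
  by apply: (@ga_unit_monom _ _ _ h); rewrite mulrC.
have supp_mul (g g' : laurent k P) u v : msupp g = [fset u]%fset ->
    msupp g' = [fset v]%fset -> u + v \in msupp (g * g').
  (* Both supports are singletons, so the zero functional serves: no other exponent competes. *)
  move=> gu g'v; apply: (@ga_mul_extremal _ _ (fun=> 0)) => [? ?||z||z];
    rewrite ?gu ?g'v ?inE ?addr0 // => /eqP->; by rewrite eqxx.
have yy0 : y + y' = 0.
  have := supp_mul _ _ _ _ hy hy'.
  by rewrite hh1 -monom0 msupp_monom inE => /eqP.
(* A monomial of the source that attains the [i]-th bound is sent into the target, which gives one
   inequality. The inverse map gives the other, since [y' = - y]. *)
have trans a1 a2 (f : {linear divisorial k e a1 -> divisorial k e a2}) g u i :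
    (forall t, val (f t) = g * val t) -> msupp g = [fset u]%fset ->
    a2 0 i <= a1 0 i + sigma u (e i).
  move=> fE gu; have [z [zi zge]] := exists_tight_row a1 i.
  have zP : monom k z \in divisorial_pred e a1.
    by rewrite monom_divisorial; apply/forallP.
  have := divisorial_predP _ _ _ (valP (f (Sub (monom k z) zP))) (u + z).
  rewrite fE /= => /(_ (supp_mul _ _ _ _ gu (msupp_monom _ _)))/(_ i).
  by rewrite sigmaD zi addrC.
exists y => i; apply/eqP; rewrite eq_le (trans _ _ _ _ _ _ hE hy) /=.
have := trans _ _ _ _ _ i h'E hy'.
have : sigma (y + y') (e i) = 0 by rewrite yy0 sigma0.
by rewrite sigmaD; clear; lra.
Qed.

End DivisorialIso.

(** * The region at integral points and the criterion *)

Section ConicRegion.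
Context {disp : Order.disp_t} (P : finPOrderType disp) (d r : nat).
Context (e : 'I_(d + r) -> edge P) (e_bij : bijective e).

(** The tree edges carry the zero entries of [row_mx 0 a], so they add nothing to the sum over
    [X]. *)
Lemma sum_nontree_edges (R : pzRingType) (a : 'rV[int]_r) (B : edge P -> int)
    (X : {set edge P}) :
  (forall i, B (e i) = row_mx 0 a 0 i) ->
  \sum_(l < r | e (rshift d l) \in X :&: nontree_edges e)
    (map_mx (fun c : int => c%:~R : R) a) 0 l = (\sum_(f in X) B f)%:~R.
Proof.
move=> Be; rewrite (reindex e) /=; last exact: onW_bij.
rewrite big_split_ord /= [X in X + _]big1 ?add0r => [|i _]; last first.
  by rewrite Be row_mxEl mxE.
rewrite rmorph_sum; apply: eq_big => [l|l _]; last first.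
  by rewrite mxE Be row_mxEr.
by rewrite inE andb_idr // => _; apply: imset_f.
Qed.

Lemma in_conic_regionE (R : realType) (a : 'rV[int]_r) (B : edge P -> int) :
  (forall i, B (e i) = row_mx 0 a 0 i) ->
  in_conic_region e (map_mx (fun c : int => c%:~R : R) a) <->
  forall C, circuit C ->
    - #|Xminus C|%:R + 1 <= \sum_(f in Xplus C) B f - \sum_(f in Xminus C) B f
                         <= #|Xplus C|%:R - 1.
Proof.
move=> Be; suff boundsE : forall (p q : nat) (s : int),
    (- p%:R + 1 <= (s%:~R : R) <= q%:R - 1) = (- p%:R + 1 <= s <= q%:R - 1).
  by split=> region C /region; rewrite /Zplus /Zminus
    !(sum_nontree_edges R _ Be) -rmorphB boundsE.
move=> p q s; congr (_ && _);
  by rewrite -[RHS](ler_int R) ?rmorphD ?rmorphB /= ?rmorphN /=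
    ?rmorph_nat ?rmorph1.
Qed.

End ConicRegion.

Theorem theorem1p3 (R : realType) (k : closedFieldType)
    (disp : Order.disp_t) (P : finPOrderType disp)
    (r : nat) (e : 'I_(#|P|.+1 + r) -> edge P)
    (e_bij : bijective e)
    (e_tree : spanning_tree [set e (lshift r i) | i : 'I_(#|P|.+1)])
    (a : 'rV[int]_r) :
  conic R e (divisorial k e (row_mx 0 a))
  <-> in_conic_region e (map_mx (fun c : int => c%:~R : R) a).
Proof.
have [B Be] := row_edge e_bij (row_mx 0 a).
apply: (iff_trans _ (iff_sym (in_conic_regionE e_bij R Be))).
split=> [[x iso] C [cC _] | region].
  have [y yE] := divisorial_iso_translate e_bij iso.
  (* The round-up of sigma(x) is (0, a) + sigma(y) with y integral, so that x - y has round-up (0,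
     a) itself. *)
  pose g h := Defs.coord x h - (Defs.coord y h)%:~R.
  apply: (@cycle_bounds _ _ _ (of_potential g)) cC => f.
  have [i ->] : exists i, f = e i by case: e_bij => g' _ gK; exists (g' f).
  have -> : sigma (of_potential g) (e i) = sigma x (e i) - (sigma y (e i))%:~R.
    by rewrite sigma_of_potential /g /sigma rmorphB /=; lra.
  have := yE i; rewrite mxE -Be => cE.
  rewrite ceilDrz ?rpredN ?intr_int // -rmorphN intrKceil.
  by rewrite cE addrK.
have [C circC|x xB] := @ceil_sigma_exists _ P R B.
  have UC := is_cycle_uniq (proj1 circC).
  (* By [csum_weight] the left inequality says that the cyclic weight is at least 1. *)
  by have /andP[+ _] := region C circC; rewrite csum_weight //; lra.
exists x; have -> : \row_i Num.ceil (sigma x (e i)) = row_mx 0 a.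
  by apply/rowP => i; rewrite mxE xB Be.
by exists idfun; exists id.
Qed.
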